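(* Restricted to instances with $k_{\#} \geq 1$, any deterministic algorithm for the minimum, sorting, or MST problem under uncertainty has competitive ratio $\rho\geq 2$.
   Context: Each uncertain element $i$ has an interval $I_i$ that is open $(L_i,U_i)$ or trivial $\{w_i\}$, an unknown true value $w_i\in I_i$ (revealed by a query) and a predicted value $\bar w_i\in I_i$. Minimum problem: given intervals and a family $\mathcal{S}$ of subsets, determine for each set an element of minimum true value. Sorting problem: determine for each set the order by true value. MST problem: graph with an interval and prediction per edge weight; determine a spanning tree that is an MST for the true weights. A query set is feasible if the answer is the same for all value assignments in the intervals agreeing with the true values on it; $\mathrm{opt}$ is the minimum size of a feasible query set. An adaptive algorithm stops once its queries are feasible; it has competitive ratio $\rho$ on a class of instances if $|\mathrm{ALG}|\le\rho\cdot\mathrm{opt}$ on every instance of the class. $k_{\#}=|\{i: w_i\ne\bar w_i\}|$ is the number of inaccurate predictions. *)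

(* Defs.v *)
From HB Require Import structures.
From mathcomp Require Import all_boot all_order all_algebra.
From mathcomp Require Import boolp reals.

Set Implicit Arguments.
Unset Strict Implicit.
Unset Printing Implicit Defensive.

Import Order.TTheory GRing.Theory Num.Theory.
Local Open Scope ring_scope.

(* A problem is given by its combinatorial structures (e.g. a set family or a
   graph), the uncertain elements of a structure, and the relation
   [correct s w a]: the answer a solves s when the elements have values w. *)
Record problem (R : realType) := Problem {
  structure : Type;
  elt : structure -> finType;
  valid : structure -> Prop;
  answer : structure -> Type;
  correct : forall s : structure, (elt s -> R) -> answer s -> Prop }.

Section Uncertainty.
Variables (R : realType) (P : problem R).

(* What the algorithm knows before making any query. *)
Record input := Input {
  base : structure P;
  itv : elt base -> interval R;
  predicted : elt base -> R }.

Definition open_or_trivial (I : interval R) : Prop :=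
  (exists L U : R, L < U /\ I = `]L, U[) \/ (exists w : R, I = `[w, w]).

Definition realizes (X : input) (w : elt (base X) -> R) : Prop :=
  forall i, w i \in itv i.

Definition valid_input (X : input) : Prop :=
  [/\ valid (base X), forall i, open_or_trivial (itv (i : elt (base X)))
    & realizes (@predicted X)].

(* Ties in the values may leave several correct answers; Q is feasible when
   one answer is correct for every realization agreeing with w on Q. *)
Definition feasible (X : input) (w : elt (base X) -> R)
    (Q : {set elt (base X)}) : Prop :=
  exists a : answer (base X), forall w' : elt (base X) -> R,
    realizes w' -> {in Q, w' =1 w} -> correct w' a.

(* [set: _] is only the starting point of the search for a minimum; it is
   feasible as soon as w realizes X and some answer is correct for w. *)
Definition opt (X : input) (w : elt (base X) -> R) : nat :=
  #|[arg min_(Q < [set: elt (base X)] | `[< feasible w Q >]) #|Q| ]|.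

Definition num_inaccurate (X : input) (w : elt (base X) -> R) : nat :=
  #|[set i | w i != predicted i]|.

(* The next query as a function of the input and of the queries made so far
   with the values they revealed, oldest first; None makes no further query. *)
Definition algorithm : Type :=
  forall X : input, seq (elt (base X) * R) -> option (elt (base X)).

Definition queried (X : input) (h : seq (elt (base X) * R)) :
    {set elt (base X)} := [set i in unzip1 h].

Fixpoint history (A : algorithm) (X : input) (w : elt (base X) -> R)
    (n : nat) : seq (elt (base X) * R) :=
  if n is m.+1 then
    let h := history A w m in
    if `[< feasible w (queried h) >] then h
    else if A X h is Some i then rcons h (i, w i) else h
  else [::].

(* Q is the query set of A on the instance (X, w). If A never reaches a
   feasible query set, there is no such Q. *)
Definition query_set (A : algorithm) (X : input) (w : elt (base X) -> R)
    (Q : {set elt (base X)}) : Prop :=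
  feasible w Q /\ exists n, Q = queried (history A w n).

Definition competitive_on (C : forall X : input, (elt (base X) -> R) -> Prop)
    (A : algorithm) (rho : R) : Prop :=
  forall (X : input) (w : elt (base X) -> R),
    valid_input X -> realizes w -> C X w ->
    exists Q, query_set A w Q /\ #|Q|%:R <= rho * (opt w)%:R.

Definition some_inaccurate (X : input) (w : elt (base X) -> R) : Prop :=
  (1 <= num_inaccurate w)%N.

End Uncertainty.

Section Problems.
Variable R : realType.

Record set_family := SetFamily {
  ground : finType;
  members : {set {set ground}} }.

Definition min_answer (F : set_family) : Type :=
  forall S : {set ground F}, S \in members F -> ground F.

Definition min_correct (F : set_family) (w : ground F -> R)
    (a : min_answer F) : Prop :=
  forall (S : {set ground F}) (FS : S \in members F),
    a S FS \in S /\ {in S, forall j, w (a S FS) <= w j}.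

Definition minimum_problem : problem R :=
  Problem (fun F : set_family => set0 \notin members F) min_correct.

Definition sort_answer (F : set_family) : Type :=
  forall S : {set ground F}, S \in members F -> seq (ground F).

Definition sort_correct (F : set_family) (w : ground F -> R)
    (a : sort_answer F) : Prop :=
  forall (S : {set ground F}) (FS : S \in members F),
    perm_eq (a S FS) (enum S) /\ sorted (fun i j => w i <= w j) (a S FS).

Definition sorting_problem : problem R :=
  Problem (fun _ : set_family => True) sort_correct.

Record graph := Graph {
  vertex : finType;
  edge : finType;
  ends : edge -> {set vertex} }.

Definition adj (G : graph) (F : {set edge G}) : rel (vertex G) :=
  fun u v => [exists e in F, ends e == [set u; v]].

Definition connected (G : graph) (F : {set edge G}) : Prop :=
  forall u v, connect (adj F) u v.

(* In a simple graph a cycle has at least three vertices. *)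
Definition acyclic (G : graph) (F : {set edge G}) : Prop :=
  forall c : seq (vertex G), ucycle (adj F) c -> (size c < 3)%N.

Definition simple_connected (G : graph) : Prop :=
  [/\ injective (@ends G), forall e : edge G, #|ends e| = 2%N
    & connected [set: edge G]].

Definition spanning_tree (G : graph) (F : {set edge G}) : Prop :=
  connected F /\ acyclic F.

Definition mst_correct (G : graph) (w : edge G -> R) (F : {set edge G}) :
    Prop :=
  spanning_tree F /\
  forall F' : {set edge G}, spanning_tree F' ->
    \sum_(e in F) w e <= \sum_(e in F') w e.

Definition mst_problem : problem R := Problem simple_connected mst_correct.

End Problems.

(* Main.v *)
Require Import Defs.
From mathcomp Require Import all_boot all_order all_algebra.
From mathcomp Require Import boolp reals.
From mathcomp Require Import lra zify.

(** Take two elements x and y with intervals ]0, 2[ and ]1, 3[, both predicted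
    at 3/2, such that a correct answer decides which of them is smaller.
    Whichever of the two is queried first has the predicted value, which lies in
    both intervals and so settles nothing, while the other one has a mispredicted
    value outside the overlap: querying the latter alone is enough.  All further
    elements are trivial, and querying one of them first settles nothing
    either.  For the MST problem x and y are two edges of a triangle whose
    third edge has weight 0, so that a minimum spanning tree drops the heavier
    one of x and y. *)

Set Implicit Arguments.
Unset Strict Implicit.
Unset Printing Implicit Defensive.

Import Order.TTheory GRing.Theory Num.Theory.
Local Open Scope ring_scope.

(** * An adversary against the first query *)

Section LowerBound.
Variables (R : realType) (P : problem R).
Implicit Types (X : input P) (A : algorithm P).

Lemma feasible_subset X (w : elt (base X) -> R) (Q Q' : {set elt (base X)}) :
  Q \subset Q' -> feasible w Q -> feasible w Q'.
Proof.
move=> /subsetP sQ [a ha]; exists a => w' rw' ww'.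
by apply: ha => // i iQ; apply/ww'/sQ.
Qed.

Lemma opt_le X (w : elt (base X) -> R) (Q : {set elt (base X)}) :
  feasible w Q -> (opt w <= #|Q|)%N.
Proof.
move=> fQ; rewrite /opt; case: arg_minnP => [|Q' _]; last by apply; apply/asboolP.
by apply/asboolP; apply: feasible_subset (subsetT Q) fQ.
Qed.

Lemma history0 A X (w : elt (base X) -> R) n :
  A X [::] = None -> history A w n = [::].
Proof. by move=> A0; elim: n => //= n ->; rewrite A0; case: ifP. Qed.

(** A history only grows at its end, so the first query is never lost. The history can stay empty
    only for [n = 0] or when the empty set is already feasible. *)
Lemma history_first A X (w : elt (base X) -> R) n i :
  A X [::] = Some i ->
  history A w n = [::] \/ i \in queried (history A w n).
Proof.
move=> Ai; elim: n => [|n IHn] /=; first by left.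
case: ifP => // _; case: IHn => [->|iQ].
  by rewrite Ai; right; rewrite !inE.
case: (A X _) => [j|]; right => //.
by move: iQ; rewrite !inE /unzip1 map_rcons mem_rcons inE => ->; rewrite orbT.
Qed.

(** The first query depends on the input alone, so the adversary may fix the values after seeing it.
    It then leaves the algorithm with at least two queries where one would do. *)
Lemma competitive_ge2 X (i0 : elt (base X)) A (rho : R) :
  valid_input X ->
  (forall i, exists w : elt (base X) -> R,
    [/\ realizes w, some_inaccurate w, ~ feasible w [set i]
      & exists j, feasible w [set j]]) ->
  competitive_on (@some_inaccurate R P) A rho -> 2 <= rho.
Proof.
move=> vX adv cA.
(* The default [i0] covers an algorithm that makes no query at all; it is refuted below since the
   empty set is infeasible. *)
pose i := odflt i0 (A X [::]).
have [w [rw iw nfi [j fj]]] := adv i.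
have nf0 : ~ feasible w set0.
  by move=> f0; apply: nfi; apply: feasible_subset (sub0set _) f0.
have [Q [[fQ [n Qn]] leQ]] := cA X w vX rw iw.
have queried_nil : queried [::] = set0 :> {set elt (base X)}.
  by apply/setP => k; rewrite !inE.
have iQ : i \in Q.
  case Ai : (A X [::]) => [k|]; last first.
    by case: nf0; rewrite -queried_nil -(history0 w n Ai) -Qn.
  rewrite /i Ai /=; case: (history_first w n Ai); last by rewrite Qn.
  by move=> h0; case: nf0; rewrite -queried_nil -h0 -Qn.
have Q2 : (2 <= #|Q|)%N.
  rewrite ltnNge; apply/negP => Q1; apply: nfi.
  suff -> : [set i] = Q by [].
  by apply/eqP; rewrite eqEcard sub1set iQ cards1.
have := opt_le fj; rewrite cards1.
have Q2R : (2 : R) <= #|Q|%:R by rewrite ler_nat.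
(* Only 0 and 1 remain for [opt w]: 0 would force [Q] to be empty, and 1 gives
   [2 <= #|Q| <= rho]. *)
case: (opt w) leQ => [|[|//]] leQ _; lra.
Qed.

End LowerBound.

(** * Comparing two overlapping intervals *)

Section Comparison.
Variables (R : realType) (P : problem R) (s : structure P) (x y : elt s).

Definition comparison_itv (i : elt s) : interval R :=
  if i == x then `]0, 2[ else if i == y then `]1, 3[ else `[0, 0].

Definition comparison_input : input P :=
  @Input R P s comparison_itv
    (fun i => if (i == x) || (i == y) then 3 / 2 else 0).

Hypotheses (sV : valid s) (xy : x != y).
(** This and [answer_decides] are what the three problems have in common. The direction is fixed
    because the adversary always makes [x] the smaller element. *)
Hypothesis x_answer : exists a : answer s, forall w : elt s -> R,
  realizes (X := comparison_input) w -> w x <= w y -> correct w a.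
Hypothesis answer_decides : forall a : answer s,
  (forall w : elt s -> R,
     realizes (X := comparison_input) w -> correct w a -> w x <= w y) \/
  (forall w : elt s -> R,
     realizes (X := comparison_input) w -> correct w a -> w y <= w x).

Definition comparison_val (a b : R) (i : elt s) : R :=
  if i == x then a else if i == y then b else 0.

Lemma comparison_valx a b : comparison_val a b x = a.
Proof. by rewrite /comparison_val eqxx. Qed.

Lemma comparison_valy a b : comparison_val a b y = b.
Proof. by rewrite /comparison_val eq_sym (negPf xy) eqxx. Qed.

Lemma comparison_realizes a b : 0 < a < 2 -> 1 < b < 3 ->
  realizes (X := comparison_input) (comparison_val a b).
Proof.
move=> ha hb i /=; rewrite /comparison_itv /comparison_val.
by case: eqP => _; last case: eqP => _; rewrite in_itv //= lexx.
Qed.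

Lemma realizes_x (w : elt s -> R) :
  realizes (X := comparison_input) w -> 0 < w x < 2.
Proof. by move=> /(_ x) /=; rewrite /comparison_itv eqxx in_itv. Qed.

Lemma realizes_y (w : elt s -> R) :
  realizes (X := comparison_input) w -> 1 < w y < 3.
Proof.
by move=> /(_ y) /=; rewrite /comparison_itv eq_sym (negPf xy) eqxx in_itv.
Qed.

Lemma realizes_other (w : elt s -> R) i : i != x -> i != y ->
  realizes (X := comparison_input) w -> w i = 0.
Proof.
move=> /negPf ix /negPf iy /(_ i) /=; rewrite /comparison_itv ix iy in_itv /=.
by rewrite -eq_le => /eqP.
Qed.

Lemma comparison_valid : valid_input comparison_input.
Proof.
split=> // i /=; last first.
  rewrite /comparison_itv; case: eqP => _ /=; last case: eqP => _ /=.
  - by rewrite in_itv /=; lra.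
  - by rewrite in_itv /=; lra.
  - by rewrite in_itv /= lexx.
rewrite /comparison_itv; case: eqP => _; last case: eqP => _.
- by left; exists 0, 2; split=> //; lra.
- by left; exists 1, 3; split=> //; lra.
- by right; exists 0.
Qed.

(** A single answer would have to be correct for two realizations that order [x] and [y] strictly in
    opposite ways, yet every answer commits to one order. *)
Lemma undecided (w : elt s -> R) (Q : {set elt s}) (a b a' b' : R) :
  0 < a < 2 -> 1 < b < 3 -> 0 < a' < 2 -> 1 < b' < 3 ->
  a < b -> b' < a' ->
  {in Q, comparison_val a b =1 w} -> {in Q, comparison_val a' b' =1 w} ->
  ~ feasible (X := comparison_input) w Q.
Proof.
move=> ha hb ha' hb' ab ba' wQ wQ' [ans hans].
have r := comparison_realizes ha hb; have r' := comparison_realizes ha' hb'.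
have := hans _ r wQ; have := hans _ r' wQ'.
case: (answer_decides ans) => dec c' c.
- by have := dec _ r' c'; rewrite comparison_valx comparison_valy; lra.
- by have := dec _ r c; rewrite comparison_valx comparison_valy; lra.
Qed.

Lemma comparison_competitive_ge2 (A : algorithm P) (rho : R) :
  competitive_on (@some_inaccurate R P) A rho -> 2 <= rho.
Proof.
apply: (competitive_ge2 (X := comparison_input) x comparison_valid) => i.
have [ans hans] := x_answer.
have [->{i}|iy] := eqVneq i y.
(* First query [y]: the value 1/2 of [x] lies below the whole interval of [y], so [x] alone
   decides. *)
- exists (comparison_val (1 / 2) (3 / 2)); split.
  + by apply: comparison_realizes; lra.
  + rewrite /some_inaccurate /num_inaccurate card_gt0; apply/set0Pn; exists x.
    by rewrite inE /= comparison_valx eqxx /=; apply/eqP; lra.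
  (* With [y] known to be 3/2, [x] can still lie on either side of it. *)
  + apply: (@undecided _ _ (1 / 2) (3 / 2) (7 / 4) (3 / 2)); try lra.
    by move=> j; rewrite inE => /eqP ->.
    by move=> j; rewrite inE => /eqP ->; rewrite !comparison_valy.
  + exists x, ans => w rw /(_ x); rewrite inE eqxx comparison_valx => wx.
    by apply: hans => //; have := realizes_y rw; have := wx isT; lra.
(* First query [x] or a trivial element: the value 5/2 of [y] lies above the whole interval of
   [x]. *)
- exists (comparison_val (3 / 2) (5 / 2)); split.
  + by apply: comparison_realizes; lra.
  + rewrite /some_inaccurate /num_inaccurate card_gt0; apply/set0Pn; exists y.
    by rewrite inE /= comparison_valy eqxx orbT /=; apply/eqP; lra.
  (* Both assignments differ from [w] only at [y], which moves to either side of 3/2. *)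
  + apply: (@undecided _ _ (3 / 2) (7 / 4) (3 / 2) (5 / 4)); try lra.
    by move=> j; rewrite inE => /eqP ->; rewrite /comparison_val (negPf iy).
    by move=> j; rewrite inE => /eqP ->; rewrite /comparison_val (negPf iy).
  + exists y, ans => w rw /(_ y); rewrite inE eqxx comparison_valy => wy.
    by apply: hans => //; have := realizes_x rw; have := wy isT; lra.
Qed.

End Comparison.

(** * Minimum and sorting on one set of two elements *)

Definition pair_family : set_family := SetFamily [set [set: bool]].

Lemma minimum_competitive_ge2 (R : realType)
    (A : algorithm (minimum_problem R)) (rho : R) :
  competitive_on (@some_inaccurate R (minimum_problem R)) A rho -> 2 <= rho.
Proof.
apply: (@comparison_competitive_ge2 R (minimum_problem R) pair_family false true).
- by rewrite /= inE eq_sym; apply/set0Pn; exists true; rewrite inE.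
- by [].
- exists (fun _ _ => false) => w _ le01 S FS.
  have /set1P -> := FS; split; first by rewrite inE.
  by case.
- move=> a; pose FT := set11 [set: bool].
  case E : (a [set: bool] FT); [right|left] => w _ /(_ _ FT) [_];
    by rewrite E; apply; rewrite inE.
Qed.

Lemma sorting_competitive_ge2 (R : realType)
    (A : algorithm (sorting_problem R)) (rho : R) :
  competitive_on (@some_inaccurate R (sorting_problem R)) A rho -> 2 <= rho.
Proof.
apply: (@comparison_competitive_ge2 R (sorting_problem R) pair_family false true).
- by [].
- by [].
- exists (fun _ _ => [:: false; true]) => w _ le01 S FS.
  have /set1P -> := FS; split; last by rewrite /= le01.
  by apply: uniq_perm => [||[]]; rewrite ?enum_uniq ?mem_enum ?inE.
- move=> a; pose FT := set11 [set: bool].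
  (* An answer that is not a permutation is never correct, so either alternative holds vacuously. *)
  have [pa|npa] := boolP (perm_eq (a [set: bool] FT) (enum [set: bool])); last first.
    by left=> w _ /(_ _ FT) [pa]; rewrite pa in npa.
  have ua : uniq (a [set: bool] FT) by rewrite (perm_uniq pa) enum_uniq.
  have sa : size (a [set: bool] FT) = 2%N.
    by rewrite (perm_size pa) -cardE cardsT card_bool.
  case E : (a [set: bool] FT) ua sa => [|u [|v [|? ?]]] //= uv _.
  by case: u v uv E => [] [] // _ E; [right|left] => w _ /(_ _ FT) [_];
    rewrite E /= andbT.
Qed.

(** * Spanning trees of the triangle *)

Lemma ord3_neqE (e u v t : 'I_3) :
  uniq [:: e; u; v] -> (t != e) = (t == u) || (t == v).
Proof.
rewrite /= !inE -!val_eqE /=.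
by move: (ltn_ord t) (ltn_ord e) (ltn_ord u) (ltn_ord v); lia.
Qed.

(* Edge e of the triangle joins the two vertices other than e. *)
Definition triangle : graph := Graph (fun e : 'I_3 => [set~ e]).

Lemma triangle_adj (F : {set edge triangle}) (e u v : 'I_3) :
  uniq [:: e; u; v] -> adj F u v = (e \in F).
Proof.
move=> euv.
have E t : (ends t == [set u; v] :> {set vertex triangle}) = (t == e).
  rewrite (_ : [set u; v] = [set~ e]); last first.
    by apply/setP => k; rewrite !inE (ord3_neqE k euv).
  by rewrite /= (inj_eq (@setC_inj _)) (inj_eq set1_inj).
apply/existsP/idP => [[t /andP[tF]]|eF]; first by rewrite E => /eqP <-.
by exists e; rewrite eF E eqxx.
Qed.

Lemma triangle_adj_neq (F : {set edge triangle}) (u v : 'I_3) :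
  adj F u v -> u != v.
Proof.
case/existsP => e /andP[_ /eqP E]; apply/eqP => uv.
have : #|[set~ e]| = 2%N by rewrite cardsC1 card_ord.
by rewrite [[set~ e]]E uv setUid cards1.
Qed.

Lemma third_vertex (u v : 'I_3) : u != v -> exists e : 'I_3, uniq [:: e; u; v].
Proof.
move=> uv.
have : ~~ ([set: 'I_3] \subset [set u; v]).
  by apply/negP => /subset_leq_card; rewrite cardsT card_ord cards2 uv.
case/subsetPn => e _; rewrite !inE => euv; exists e.
by rewrite /= !inE euv uv.
Qed.

(** A cycle on more than two vertices visits all three, and its three consecutive pairs are joined
    by the three different edges. *)
Lemma triangle_cycle (F : {set edge triangle}) (c : seq 'I_3) :
  ucycle (adj F) c -> (2 < size c)%N -> F = [set: edge triangle].
Proof.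
move=> /andP[cF uc] c2.
have : (size c <= 3)%N by rewrite -(card_uniqP uc) -[3%N]card_ord max_card.
case: c cF uc c2 => [|a [|b [|d []]]] //= /and4P[ab bd da _] uc _ _.
apply/setP => e; rewrite inE.
have : e \in [:: a; b; d].
  by rewrite !inE -(ord3_neqE e (uc : uniq [:: a; b; d])) orbN.
rewrite !inE => /or3P[] /eqP ->.
- by rewrite -(@triangle_adj F a b d).
- by rewrite -(@triangle_adj F b d a) // -(rot_uniq 2).
- by rewrite -(@triangle_adj F d a b) // -(rot_uniq 1).
Qed.

Lemma adj_sym (G : graph) (F : {set edge G}) : symmetric (adj F).
Proof. by move=> u v; apply: eq_existsb => e; rewrite setUC. Qed.

(** The edges other than [e] form a star centred at the vertex [e], so any two vertices are linked
    through it. *)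
Lemma triangle_connected (F : {set edge triangle}) (e : 'I_3) :
  [set~ e] \subset F -> connected F.
Proof.
move=> /subsetP sF u v.
have conn_e k : connect (adj F) e k.
  have [-> //|ke] := eqVneq e k.
  have [t tu] := third_vertex ke; apply: connect1.
  rewrite (triangle_adj F tu); apply: sF; rewrite !inE.
  by move: tu; rewrite /= !inE negb_or => /andP[/andP[]].
apply: connect_trans (conn_e v).
by rewrite (sym_connect_sym (adj_sym F)) conn_e.
Qed.

Lemma triangle_tree (e : 'I_3) :
  spanning_tree ([set~ e] : {set edge triangle}).
Proof.
split=> [|c cF]; first exact: triangle_connected (subxx _).
rewrite ltnNge; apply/negP => c3.
by have /setP/(_ e) := triangle_cycle cF c3; rewrite !inE eqxx.
Qed.

Lemma triangle_simple : simple_connected triangle.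
Proof.
split=> [e f /setP/(_ f)|e|] /=.
- by rewrite !inE eqxx /= => /negbFE /eqP.
- by rewrite cardsC1 card_ord.
- exact: triangle_connected (subsetT [set~ ord0]).
Qed.

(** The edges at the vertex [e] are exactly [u] and [v], and a path leaving this vertex must start
    with one of them. *)
Lemma triangle_connected_cover (F : {set edge triangle}) (e u v : 'I_3) :
  uniq [:: e; u; v] -> connected F -> u \in F \/ v \in F.
Proof.
move=> euv /(_ e u) /connectP[p].
case: p => [_ E|k p /= /andP[ek _] _]; first by move: euv; rewrite E /= inE eqxx.
have [t tek] := third_vertex (triangle_adj_neq ek).
rewrite (triangle_adj F tek) in ek.
have : t != e by move: tek; rewrite /= !inE negb_or => /andP[/andP[]].
by rewrite (ord3_neqE t euv) => /orP[] /eqP <-; [left|right].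
Qed.

(** * Minimum spanning trees of the triangle *)

Lemma mst_competitive_ge2 (R : realType)
    (A : algorithm (mst_problem R)) (rho : R) :
  competitive_on (@some_inaccurate R (mst_problem R)) A rho -> 2 <= rho.
Proof.
pose z : 'I_3 := inord 0; pose x : 'I_3 := inord 1; pose y : 'I_3 := inord 2.
have zxy : uniq [:: z; x; y] by rewrite /= !inE -!val_eqE /= !inordK.
have [zx zy xy] : [/\ z != x, z != y & x != y].
  by move: zxy; rewrite /= !inE negb_or andbT => /andP[/andP[]].
have other (t : 'I_3) : [|| t == z, t == x | t == y].
  by rewrite -(ord3_neqE t zxy) orbN.
pose X := @comparison_input R (mst_problem R) triangle x y.
have valE (w : 'I_3 -> R) : realizes (X := X) w ->
    [/\ w z = 0, 0 < w x, 0 < w y & forall t, 0 <= w t].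
  move=> rw; have wz := @realizes_other R (mst_problem R) triangle x y w z zx zy rw.
  have wx := @realizes_x R (mst_problem R) triangle x y w rw.
  have wy := @realizes_y R (mst_problem R) triangle x y xy w rw.
  split=> //; [lra|lra|] => t.
  by case/or3P: (other t) => /eqP ->; lra.
(* Weights are nonnegative, so an edge set weighs at least as much as each of its edges. *)
have member (w : 'I_3 -> R) (F : {set 'I_3}) t :
    realizes (X := X) w -> t \in F -> w t <= \sum_(e in F) w e.
  move=> /valE[_ _ _ w0] tF; rewrite (big_setD1 t tF) /= lerDl.
  exact: sumr_ge0.
have dropE (w : 'I_3 -> R) s t : realizes (X := X) w -> uniq [:: z; s; t] ->
    \sum_(e in [set~ t]) w e = w s.
  move=> /valE[wz _ _ _] zst.
  have -> : [set~ t] = [set z; s].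
    apply/setP => k; rewrite !inE (ord3_neqE (u := z) (v := s)) //.
    by rewrite -(rot_uniq 1).
  move: zst; rewrite /= !inE negb_or => /andP[/andP[zs _] _].
  by rewrite big_setU1 ?inE //= big_set1 wz add0r.
have zyx : uniq [:: z; y; x] by rewrite /= !inE negb_or zx zy eq_sym xy.
apply: (@comparison_competitive_ge2 R (mst_problem R) triangle x y) => //.
- exact: triangle_simple.
(* The tree without [y] weighs [w x]; any competitor contains [x] or [y] and so weighs at least
   [w x]. *)
- exists ([set~ y] : {set 'I_3}) => w rw lexy; split; first exact: triangle_tree.
  move=> F [cF _]; rewrite (dropE _ x) //.
  have [xF|yF] := triangle_connected_cover zxy cF; first exact: member.
  exact: le_trans lexy (member _ _ _ rw yF).
(* A minimum tree containing [y] weighs at least [w y] and at most [w x], the weight of the tree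
   without [y]. If [y] is missing, connectedness forces [x] into [F] and the roles are swapped. *)
- move=> F; have [yF|yF] := boolP (y \in (F : {set 'I_3})).
    right=> w rw [_ /(_ _ (triangle_tree y))]; rewrite (dropE _ x) //.
    exact/le_trans/member.
  left=> w rw [[cF _] /(_ _ (triangle_tree x))]; rewrite (dropE _ y) //.
  have [xF|yF'] := triangle_connected_cover zxy cF; last by rewrite yF' in yF.
  exact/le_trans/member.
Qed.

Theorem theorem13 (R : realType) :
  [/\ forall (A : algorithm (minimum_problem R)) (rho : R),
        competitive_on (@some_inaccurate R (minimum_problem R)) A rho -> 2 <= rho,
      forall (A : algorithm (sorting_problem R)) (rho : R),
        competitive_on (@some_inaccurate R (sorting_problem R)) A rho -> 2 <= rho
    & forall (A : algorithm (mst_problem R)) (rho : R),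
        competitive_on (@some_inaccurate R (mst_problem R)) A rho -> 2 <= rho].
Proof.
split.
- exact: minimum_competitive_ge2.
- exact: sorting_competitive_ge2.
- exact: mst_competitive_ge2.
Qed.
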